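(* Suppose that $\Phi(x)=\sum_{i=1}^n\phi(x_i)$ with $\phi:\mathbb{R}\to\mathbb{R}$ being H\''older continuous with exponent $p$ for some $0<p<1$, i.e. there exists $K>0$ such that $|\phi(s)-\phi(t)|\le K|s-t|^p$ for any $s,t\in\mathbb{R}$. Take any $\epsilon>0$ and fix any $\tilde x\in S$. Let $C>0$ be a constant such that for all $x\in\mathbb{R}^n$ $$\mathrm{dist}(x,S)\le C\left[(\|Ax-b\|^2-\sigma^2)_+ +\|(Bx-h)_+\|_1+\|(Dx-d)_+\|_1\right],$$ and consider any $$\lambda>\frac{K^{1/p}\,C\,\Phi(\tilde x)}{\left(n^{\frac p2-1}\epsilon\right)^{1/p}}.$$ Then for any global minimizer $x_\lambda$ of $\min_{x\in S_1}F_\lambda(x)$, the projection $P_S(x_\lambda)$ is an $\epsilon$-minimizer of $\min\{\Phi(x):x\in S\}$, i.e. $P_S(x_\lambda)\in S$ and $\Phi(P_S(x_\lambda))\le\inf_{x\in S}\Phi(x)+\epsilon$.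
   Context: Standing setting. $\Phi:\mathbb{R}^n\to\mathbb{R}$ is a nonnegative continuous function. $A\in\mathbb{R}^{m\times n}$ has full row rank, $b\in\mathbb{R}^m$, $\sigma\ge 0$, $B\in\mathbb{R}^{\ell\times n}$, $h\in\mathbb{R}^\ell$, and $D$, $d$ are a matrix and a vector of compatible sizes. $S_1=\{x\in\mathbb{R}^n: Dx\le d\}$, $S_2=\{x\in\mathbb{R}^n:\|Ax-b\|\le\sigma,\ Bx\le h\}$, $S=S_1\cap S_2$ (inequalities componentwise, $\|\cdot\|$ Euclidean), and there exists $x_0\in S$ with $\|Ax_0-b\|<\sigma$. For a vector (or scalar) $a$, $a_+$ has entries $\max\{a_i,0\}$; $\mathrm{dist}(x,S)=\inf_{y\in S}\|x-y\|$, and $P_S(x)$ is the Euclidean projection of $x$ onto the closed convex set $S$. A constant $C>0$ satisfying the displayed error bound always exists in this setting (a known result of Luo and Luo). For $\lambda>0$, $$F_\lambda(x)=\lambda\left[(\|Ax-b\|^2-\sigma^2)_+ +\|(Bx-h)_+\|_1\right]+\Phi(x).$$ *)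

(* Defs.v *)
From HB Require Import structures.
From mathcomp Require Export all_boot all_order all_algebra.
From mathcomp Require Export all_classical all_reals all_analysis.

Set Implicit Arguments.
Unset Strict Implicit.
Unset Printing Implicit Defensive.

Import Order.TTheory GRing.Theory Num.Theory.
Import numFieldNormedType.Exports.

Local Open Scope classical_set_scope.
Local Open Scope ring_scope.

(* The library norm `|x| on 'cV[R]_n is the sup norm, hence a separate
   Euclidean norm; both induce the topology used by [continuous]. *)
Definition norm2 (R : realType) (n : nat) (x : 'cV[R]_n) : R :=
  Num.sqrt (\sum_(i < n) x i 0 ^+ 2).

Definition norm1 (R : realType) (n : nat) (x : 'cV[R]_n) : R :=
  \sum_(i < n) `|x i 0|.

Definition pospart (R : realType) (a : R) : R := Num.max a 0.

Definition vpospart (R : realType) (n : nat) (x : 'cV[R]_n) : 'cV[R]_n :=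
  map_mx (@pospart R) x.

Definition vle (R : realType) (n : nat) (x y : 'cV[R]_n) : Prop :=
  forall i : 'I_n, x i 0 <= y i 0.

Definition euclid_dist (R : realType) (n : nat) (x : 'cV[R]_n)
    (S : set 'cV[R]_n) : R :=
  inf [set norm2 (x - y) | y in S].

(* The default value x of [xget] is returned only when S has no point nearest
   to x. *)
Definition euclid_proj (R : realType) (n : nat) (S : set 'cV[R]_n)
    (x : 'cV[R]_n) : 'cV[R]_n :=
  xget x [set y | S y /\ forall z, S z -> norm2 (x - y) <= norm2 (x - z)].

Definition S1 (R : realType) (n k : nat) (D : 'M[R]_(k, n)) (d : 'cV[R]_k) :
    set 'cV[R]_n :=
  [set x | vle (D *m x) d].

Definition S2 (R : realType) (n m l : nat) (A : 'M[R]_(m, n)) (b : 'cV[R]_m)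
    (sigma : R) (B : 'M[R]_(l, n)) (h : 'cV[R]_l) : set 'cV[R]_n :=
  [set x | norm2 (A *m x - b) <= sigma /\ vle (B *m x) h].

Definition feasible (R : realType) (n m l k : nat) (A : 'M[R]_(m, n))
    (b : 'cV[R]_m) (sigma : R) (B : 'M[R]_(l, n)) (h : 'cV[R]_l)
    (D : 'M[R]_(k, n)) (d : 'cV[R]_k) : set 'cV[R]_n :=
  S1 D d `&` S2 A b sigma B h.

Definition penalty (R : realType) (n m l : nat) (A : 'M[R]_(m, n))
    (b : 'cV[R]_m) (sigma : R) (B : 'M[R]_(l, n)) (h : 'cV[R]_l)
    (x : 'cV[R]_n) : R :=
  pospart (norm2 (A *m x - b) ^+ 2 - sigma ^+ 2)
  + norm1 (vpospart (B *m x - h)).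

Definition F_lambda (R : realType) (n m l : nat) (A : 'M[R]_(m, n))
    (b : 'cV[R]_m) (sigma : R) (B : 'M[R]_(l, n)) (h : 'cV[R]_l)
    (Phi : 'cV[R]_n -> R) (lambda : R) (x : 'cV[R]_n) : R :=
  lambda * penalty A b sigma B h x + Phi x.

Definition global_minimizer (R : realType) (T : Type) (f : T -> R) (S : set T)
    (x : T) : Prop :=
  S x /\ forall y, S y -> f x <= f y.

Definition eps_minimizer (R : realType) (T : Type) (f : T -> R) (S : set T)
    (eps : R) (x : T) : Prop :=
  S x /\ f x <= inf [set f y | y in S] + eps.

Definition hoelder_continuous_with (R : realType) (K p : R) (phi : R -> R) :
    Prop :=
  forall s t : R, `|phi s - phi t| <= K * `|s - t| `^ p.

(* Main.v *)
(* Let x_l minimize F_lambda over S1 and let P be its projection on S. The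
   penalty vanishes on S, so lambda * penalty x_l + Phi x_l <= Phi y for all y
   in S. Taking y := xt bounds the penalty by Phi xt / lambda, hence, by the
   error bound, |x_l - P| <= C * Phi xt / lambda. Hoelder continuity and the
   power-mean inequality give
   |Phi x_l - Phi P| <= K * n `^ (1 - p / 2) * |x_l - P| `^ p <= eps,
   so Phi P <= Phi x_l + eps <= Phi y + eps for all y in S. *)

Require Import Defs.
From mathcomp Require Import all_boot all_order all_algebra.
From mathcomp Require Import all_classical all_reals all_analysis.
Unset Printing Implicit Defensive.
Import Order.TTheory GRing.Theory Num.Theory.
Import numFieldNormedType.Exports.
Local Open Scope classical_set_scope.
Local Open Scope ring_scope.

Set Implicit Arguments.
Unset Strict Implicit.

Lemma powR_invl (R : realType) (x q : R) : 0 <= x -> x^-1 `^ q = (x `^ q)^-1.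
Proof. by move=> x0; rewrite -powR_inv1// -powRrM mulN1r powRN. Qed.

Lemma powR_le_tangent (R : realType) (u q : R) :
  0 <= u -> 0 < q -> q < 1 -> u `^ q <= q * u + (1 - q).
Proof.
move=> u0 q0 q1.
have h : 0 < 1 - q by rewrite subr_gt0.
have := @conjugate_powR R (u `^ q) 1 q^-1 (1 - q)^-1 (powR_ge0 _ _) ler01.
rewrite !invr_gt0 !invrK => /(_ q0 h (subrKC _ _)).
by rewrite mulr1 -powRrM mulfV ?gt_eqF// powRr1// powR1 mul1r mulrC.
Qed.

(* Sum the tangent-line bound for the concave map t |-> t ^ q at the mean of
   the a i. *)
Lemma sum_powR_le (R : realType) (n : nat) (a : 'I_n -> R) (q : R) :
  0 < q -> q < 1 -> (forall i, 0 <= a i) ->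
  \sum_(i < n) a i `^ q <= n%:R `^ (1 - q) * (\sum_(i < n) a i) `^ q.
Proof.
move=> q0 q1 a0; set s := \sum_(i < n) a i.
have s_ge0 : 0 <= s by exact: sumr_ge0.
case: n a a0 @s s_ge0 => [|n] a a0 s s_ge0.
  by rewrite big_ord0 mulr_ge0 ?powR_ge0.
have N0 : 0 < n.+1%:R :> R by [].
have [s0|sN0] := eqVneq s 0.
  rewrite big1 ?mulr_ge0 ?powR_ge0// => i _.
  suff -> : a i = 0 by rewrite powR0 ?gt_eqF.
  move/eqP: s0; rewrite psumr_eq0// => /allP/(_ i).
  by rewrite mem_index_enum => /(_ isT)/eqP.
have s_gt0 : 0 < s by rewrite lt_neqAle eq_sym sN0.
set c := s / n.+1%:R.
have c_gt0 : 0 < c by rewrite divr_gt0.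
have c_ge0 := ltW c_gt0.
have c_q : 0 < c `^ q by exact: powR_gt0.
have -> : n.+1%:R `^ (1 - q) * s `^ q = n.+1%:R * c `^ q.
  rewrite powRB ?pnatr_eq0 ?implybT// powRr1// /c powRM ?invr_ge0//.
  by rewrite powR_invl// mulrAC mulrA.
rewrite -ler_pdivrMr// mulr_suml.
apply: (@le_trans _ _ (\sum_(i < n.+1) (q * (a i / c) + (1 - q)))).
  apply: ler_sum => i _; rewrite -powR_invl// -powRM ?invr_ge0//.
  by apply: powR_le_tangent; rewrite ?divr_ge0.
rewrite big_split/= -mulr_sumr -mulr_suml -/s sumr_const card_ord.
have -> : s / c = n.+1%:R by rewrite /c invf_div mulrCA divff// mulr1.
by rewrite -[(1 - q) *+ _]mulr_natr -mulrDl subrKC mul1r.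
Qed.

Lemma sum_norm_powR_le (R : realType) (n : nat) (x : 'cV[R]_n) (p : R) :
  0 < p -> p < 2 ->
  \sum_(i < n) `|x i 0| `^ p <= n%:R `^ (1 - p / 2) * norm2 x `^ p.
Proof.
move=> p0 p2.
have sqE (t : R) : 0 <= t -> (t ^+ 2) `^ (p / 2) = t `^ p.
  by move=> t0; rewrite -powR_mulrn// -powRrM mulrC divfK.
rewrite -[norm2 x `^ p]sqE ?sqrtr_ge0// sqr_sqrtr; last first.
  by apply: sumr_ge0 => i _; rewrite sqr_ge0.
under eq_bigr do rewrite -sqE// real_normK ?num_real//.
apply: sum_powR_le; rewrite ?divr_gt0 ?ltr_pdivrMr ?mul1r// => i.
exact: sqr_ge0.
Qed.

Lemma hoelder_sum_le (R : realType) (n : nat) (phi : R -> R) (K p : R)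
    (x y : 'cV[R]_n) :
  0 <= K -> 0 < p -> p < 2 -> hoelder_continuous_with K p phi ->
  `|\sum_(i < n) phi (x i 0) - \sum_(i < n) phi (y i 0)| <=
  K * (n%:R `^ (1 - p / 2) * norm2 (x - y) `^ p).
Proof.
move=> K0 p0 p2 hphi; rewrite -sumrB (le_trans (ler_norm_sum _ _ _))//.
apply: le_trans (ler_wpM2l K0 (sum_norm_powR_le (x - y) p0 p2)).
by rewrite mulr_sumr; apply: ler_sum => i _; rewrite !mxE; exact: hphi.
Qed.

Lemma trmx_continuous (R : realType) (m n : nat) :
  continuous (@trmx R m n).
Proof.
move=> M s /= /(nbhs_ballP M^T) [e e0 es].
apply/nbhs_ballP; exists e => //= N [_ MN]; apply: es; split=> // i j.
by rewrite !mxE; exact: MN.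
Qed.

Lemma norm2_continuous (R : realType) (n : nat) (T : topologicalType)
    (f : T -> 'cV[R]_n) :
  (forall i, continuous (fun x => f x i 0)) ->
  continuous (fun x => norm2 (f x)).
Proof.
move=> fc x.
apply: (@continuous_comp _ _ _ (fun y => \sum_(i < n) f y i 0 ^+ 2)
  (@Num.sqrt R)); last exact: sqrt_continuous.
apply: cvg_big => [|i _]; first exact: add_continuous.
by under eq_fun do rewrite expr2; apply: continuousM; exact: fc.
Qed.

Lemma mulmx_coord_continuous (R : realType) (m n : nat) (A : 'M[R]_(m, n))
    (i : 'I_m) :
  continuous (fun x : 'cV[R]_n => (A *m x) i 0).
Proof.
under eq_fun do rewrite mxE.
apply: continuous_big => [|j _]; first exact: add_continuous.
move=> x; apply: (@continuousM R 'cV[R]_n (fun=> A i j) (fun y => y j 0)).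
  exact: cst_continuous.
exact: coord_continuous.
Qed.

Lemma closed_le_continuous (R : realType) (T : topologicalType) (f : T -> R)
    (a : R) :
  continuous f -> closed [set x | f x <= a].
Proof.
by move=> fc; apply: (@closed_comp _ _ f [set t | t <= a]) => [x _|];
  [exact: fc|exact: closed_le].
Qed.

Lemma closed_vle (R : realType) (m n : nat) (A : 'M[R]_(m, n))
    (b : 'cV[R]_m) :
  closed [set x | vle (A *m x) b].
Proof.
have -> : [set x | vle (A *m x) b] =
    \bigcap_(i in [set: 'I_m]) [set x | (A *m x) i 0 <= b i 0].
  by apply/seteqP; split => [x xb i _|x xb i]; [exact: xb|exact: (xb i)].
apply: closed_bigI => i _; apply: closed_le_continuous.
exact: mulmx_coord_continuous.
Qed.

Lemma feasible_closed (R : realType) (n m l k : nat) (A : 'M[R]_(m, n))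
    (b : 'cV[R]_m) (sigma : R) (B : 'M[R]_(l, n)) (h : 'cV[R]_l)
    (D : 'M[R]_(k, n)) (d : 'cV[R]_k) :
  closed (feasible A b sigma B h D d).
Proof.
apply: closedI; first exact: closed_vle.
apply: closedI; last exact: closed_vle.
apply: closed_le_continuous; apply: norm2_continuous => i.
under eq_fun do rewrite mxE.
move=> x.
apply: (@continuousD R R^o 'cV[R]_n (fun y => (A *m y) i 0)
  (fun=> (- b) i 0)); last exact: cst_continuous.
exact: mulmx_coord_continuous.
Qed.

Lemma coord_le_norm2 (R : realType) (n : nat) (x : 'cV[R]_n) (i : 'I_n) :
  `|x i 0| <= norm2 x.
Proof.
rewrite -sqrtr_sqr ler_sqrt; last by apply: sumr_ge0 => j _; exact: sqr_ge0.
by rewrite (bigD1 i)//= lerDl; apply: sumr_ge0 => j _; exact: sqr_ge0.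
Qed.

Lemma norm2_subr_continuous (R : realType) (n : nat) (x : 'cV[R]_n) :
  continuous (fun y : 'cV[R]_n => norm2 (x - y)).
Proof.
apply: norm2_continuous => i; under eq_fun do rewrite !mxE.
move=> y; apply: (@continuousB R R^o 'cV[R]_n (fun=> x i 0) (fun z => z i 0)).
  exact: cst_continuous.
exact: coord_continuous.
Qed.

Lemma nearest_point_exists (R : realType) (n : nat) (S : set 'cV[R]_n)
    (x : 'cV[R]_n) :
  closed S -> S !=set0 ->
  exists y, S y /\ forall z, S z -> norm2 (x - y) <= norm2 (x - z).
Proof.
move=> Scl [y0 Sy0].
pose f (v : 'rV[R]_n) := norm2 (x - v^T).
pose V := [set v : 'rV[R]_n | S v^T /\ f v <= f y0^T].
have fc : continuous f.
  move=> v; apply: (@continuous_comp _ _ _ trmx (fun y => norm2 (x - y))).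
    exact: trmx_continuous.
  exact: norm2_subr_continuous.
have Vcl : closed V.
  apply: closedI; last exact: closed_le_continuous.
  by apply: (@closed_comp _ _ trmx S) => // v _; exact: trmx_continuous.
have Vbd : bounded_set V.
  exists (norm2 x + f y0^T); split; first exact: num_real.
  move=> M hM v [_ fv]; apply: le_trans (ltW hM).
  rewrite [leLHS]/Num.norm/= mx_normrE; apply/bigmax_leP; split.
    by rewrite addr_ge0 ?sqrtr_ge0.
  move=> [i j] _ /=; rewrite (ord1 i).
  have -> : v 0 j = x j 0 - (x - v^T) j 0 by rewrite !mxE subKr.
  rewrite (le_trans (ler_normB _ _))// lerD ?coord_le_norm2//.
  exact: le_trans (coord_le_norm2 _ _) fv.
have V0 : V !=set0 by exists y0^T; split; rewrite ?trmxK.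
have [c] := EVT_min_rV V0 (bounded_closed_compact Vbd Vcl) (continuous_subspaceT fc).
rewrite inE => -[Sc fc0] cmin; exists c^T; split=> // z Sz.
have [zle|/ltW zgt] := leP (f z^T) (f y0^T).
  have := cmin z^T; rewrite /f trmxK; apply.
  by rewrite inE; split; rewrite ?trmxK.
by rewrite (le_trans fc0)// (le_trans zgt)// /f trmxK.
Qed.

Lemma euclid_projP (R : realType) (n : nat) (S : set 'cV[R]_n)
    (x : 'cV[R]_n) :
  closed S -> S !=set0 ->
  S (euclid_proj S x) /\ norm2 (x - euclid_proj S x) = euclid_dist x S.
Proof.
move=> Scl S0.
have [SP Pmin] := xgetPex x (nearest_point_exists x Scl S0).
split=> //; apply/eqP; rewrite eq_le; apply/andP; split.
  by apply: lb_le_inf => [|_ [z Sz <-]]; [exact: image_nonempty|exact: Pmin].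
apply: ge_inf; last by exists (euclid_proj S x).
by exists 0 => _ [z _ <-]; exact: sqrtr_ge0.
Qed.

Lemma pospart_eq0 (R : realType) (a : R) : a <= 0 -> pospart a = 0.
Proof. exact: max_r. Qed.

Lemma norm1_vpospart_eq0 (R : realType) (n : nat) (x y : 'cV[R]_n) :
  vle x y -> norm1 (vpospart (x - y)) = 0.
Proof.
move=> xy; rewrite /norm1 big1// => i _.
by rewrite !mxE pospart_eq0 ?normr0// subr_le0.
Qed.

Lemma penalty_ge0 (R : realType) (n m l : nat) (A : 'M[R]_(m, n))
    (b : 'cV[R]_m) (sigma : R) (B : 'M[R]_(l, n)) (h : 'cV[R]_l)
    (x : 'cV[R]_n) :
  0 <= penalty A b sigma B h x.
Proof. by rewrite addr_ge0 ?sumr_ge0// /pospart le_max lexx orbT. Qed.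

Lemma penalty_eq0 (R : realType) (n m l : nat) (A : 'M[R]_(m, n))
    (b : 'cV[R]_m) (sigma : R) (B : 'M[R]_(l, n)) (h : 'cV[R]_l)
    (x : 'cV[R]_n) :
  S2 A b sigma B h x -> penalty A b sigma B h x = 0.
Proof.
move=> [Ax Bx]; rewrite /penalty norm1_vpospart_eq0// addr0 pospart_eq0//.
by rewrite subr_le0 lerXn2r ?nnegrE ?(le_trans _ Ax) ?sqrtr_ge0.
Qed.

(* The threshold on lambda is the one at which the Hoelder bound at distance
   C * a / lambda equals eps. *)
Lemma hoelder_threshold (R : realType) (N K C a p eps lambda delta : R) :
  0 < N -> 0 < K -> 0 <= C -> 0 <= a -> 0 < p -> 0 < eps -> 0 < lambda ->
  0 <= delta ->
  K `^ (1 / p) * C * a / (N `^ (p / 2 - 1) * eps) `^ (1 / p) < lambda ->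
  lambda * delta <= C * a ->
  K * (N `^ (1 - p / 2) * delta `^ p) <= eps.
Proof.
move=> N0 K0 C0 a0 p0 e0 l0 delta0 hl hd.
set E := N `^ (p / 2 - 1) * eps in hl *.
have E0 : 0 < E by rewrite mulr_gt0 ?powR_gt0.
have key : K `^ (1 / p) * delta <= E `^ (1 / p).
  rewrite -(ler_pM2l l0) mulrCA.
  apply: le_trans (ler_wpM2l (powR_ge0 _ _) hd) _.
  by rewrite mulrA -ler_pdivrMr ?powR_gt0// ltW.
have KdE : K * delta `^ p <= E.
  have := @ge0_ler_powR R p (ltW p0) _ _ _ _ key.
  rewrite !nnegrE mulr_ge0 ?powR_ge0// => /(_ isT isT).
  by rewrite powRM ?powR_ge0// -!powRrM mul1r mulVf ?gt_eqF// !powRr1 // ltW.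
rewrite mulrCA.
apply: le_trans (ler_wpM2l (powR_ge0 _ _) KdE) _.
by rewrite /E mulrA -[1 - _]opprB powRN mulVf ?mul1r// gt_eqF ?powR_gt0.
Qed.

Unset Implicit Arguments.
Set Strict Implicit.

Theorem theorem3p4 (R : realType) (n m l k : nat)
  (A : 'M[R]_(m, n)) (b : 'cV[R]_m) (sigma : R)
  (B : 'M[R]_(l, n)) (h : 'cV[R]_l)
  (D : 'M[R]_(k, n)) (d : 'cV[R]_k)
  (Phi : 'cV[R]_n -> R) (phi : R -> R) (K p : R)
  (A_full_row_rank : row_free A)
  (sigma_ge0 : 0 <= sigma)
  (slater : exists x0 : 'cV[R]_n,
      feasible A b sigma B h D d x0 /\ norm2 (A *m x0 - b) < sigma)
  (Phi_ge0 : forall x, 0 <= Phi x)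
  (Phi_cont : continuous Phi)
  (Phi_sep : forall x, Phi x = \sum_(i < n) phi (x i 0))
  (p_gt0 : 0 < p) (p_lt1 : p < 1)
  (K_gt0 : 0 < K)
  (phi_hoelder : hoelder_continuous_with K p phi)
  (eps : R) (eps_gt0 : 0 < eps)
  (xt : 'cV[R]_n) (xt_in : feasible A b sigma B h D d xt)
  (C : R) (C_gt0 : 0 < C)
  (error_bound : forall x : 'cV[R]_n,
     euclid_dist x (feasible A b sigma B h D d) <=
       C * (pospart (norm2 (A *m x - b) ^+ 2 - sigma ^+ 2)
            + norm1 (vpospart (B *m x - h))
            + norm1 (vpospart (D *m x - d))))
  (lambda : R)
  (lambda_gt : K `^ (1 / p) * C * Phi xt
                 / (n%:R `^ (p / 2 - 1) * eps) `^ (1 / p) < lambda)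
  (xl : 'cV[R]_n)
  (xl_min : global_minimizer (F_lambda A b sigma B h Phi lambda) (S1 D d) xl) :
  eps_minimizer Phi (feasible A b sigma B h D d) eps
    (euclid_proj (feasible A b sigma B h D d) xl).
Proof.
have [xl_S1 xl_opt] := xl_min.
have lambda_gt0 : 0 < lambda.
  apply: le_lt_trans lambda_gt; rewrite divr_ge0 ?powR_ge0//.
  by rewrite !mulr_ge0 ?powR_ge0// ltW.
set S := feasible A b sigma B h D d in xt_in error_bound *.
have SN0 : S !=set0 by exists xt.
have Scl : closed S by exact: feasible_closed.
have [PS dist_P] := euclid_projP xl Scl SN0.
set P := euclid_proj S xl in PS dist_P *.
have F_le y : S y -> lambda * penalty A b sigma B h xl + Phi xl <= Phi y.
  move=> [y1 y2]; have := xl_opt _ y1.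
  by rewrite /F_lambda (penalty_eq0 y2) mulr0 add0r.
have dist_le : norm2 (xl - P) <= C * penalty A b sigma B h xl.
  have := error_bound xl; rewrite dist_P => /le_trans; apply.
  by rewrite (norm1_vpospart_eq0 xl_S1) addr0.
have lambda_dist : lambda * norm2 (xl - P) <= C * Phi xt.
  apply: le_trans (ler_wpM2l (ltW lambda_gt0) dist_le) _.
  rewrite mulrCA ler_pM2l// (le_trans _ (F_le _ xt_in))// lerDl.
  exact: Phi_ge0.
have PhiP : Phi P <= Phi xl + eps.
  rewrite -lerBlDl (le_trans (ler_norm _))// distrC.
  case: (posnP n) => [n0|n_gt0].
    have -> : P = xl.
      apply/matrixP => i; suff : (i < 0)%N by [].
      by rewrite -[X in (_ < X)%N]n0 ltn_ord.
    by rewrite subrr normr0 ltW.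
  rewrite !Phi_sep; apply: le_trans (hoelder_sum_le _ _ (ltW K_gt0) p_gt0 _ phi_hoelder) _.
    by rewrite (lt_trans p_lt1)// ltr1n.
  apply: hoelder_threshold lambda_gt lambda_dist => //.
  - by rewrite ltr0n.
  - exact: ltW.
  - exact: sqrtr_ge0.
split=> //; rewrite -lerBlDr.
apply: lb_le_inf => [|_ [y Sy <-]]; first exact: image_nonempty.
rewrite lerBlDr (le_trans PhiP)// lerD2r (le_trans _ (F_le _ Sy))// lerDr.
by rewrite mulr_ge0 ?penalty_ge0// ltW.
Qed.
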